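(* Let $R$ be a commutative ring, let $n,r\ge 1$ be integers, and let $A$ be an $n\times n$ matrix over $R$ with columns $A_1,\dots,A_n$. Let $p_{i,j}\in R$ be given for $1\le j\le r$ and $1\le i\le n+j-1$, and define column vectors \[A_{n+j}=\sum_{i=1}^{n+j-1}p_{i,j}A_i,\qquad j=1,2,\dots,r.\] Let $A_r=[A_1|A_2|\cdots|A_{n+r}]$ be the resulting $n\times(n+r)$ matrix. Let $P$ be the $(n+r-1)\times r$ matrix with entries \[P_{i,j}=\begin{cases}p_{i,j}, & i\le n+j-1,\\ -1, & i=n+j,\\ 0, & i>n+j.\end{cases}\] Let $1\le j_1<j_2<\cdots<j_r<n+r$ be integers. Let $M$ be the determinant of the $n\times n$ matrix obtained from $A_r$ by deleting the columns with indices $j_1,\dots,j_r$ (the remaining columns kept in their original order), and let $Q$ be the $r\times r$ submatrix of $P$ formed by the rows with indices $j_1,\dots,j_r$ (in this order). Then \[M=(-1)^{nr+j_1+j_2+\cdots+j_r+\frac{(r-1)r}{2}}\cdot\det Q\cdot\det A.\]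
   Context: The determinant $\det Q$ is called an $n$-determinant in the paper. *)

(* Defs.v *)
From mathcomp Require Import all_boot all_order all_algebra.

Set Implicit Arguments.
Unset Strict Implicit.
Unset Printing Implicit Defensive.

Import GRing.Theory.
Local Open Scope ring_scope.

(* All indices are 0-based: [p i j] stands for p_{i+1,j+1}, and only the values
   with j < r and i < n + j are ever used. *)

(* The sequence of columns A_1, ..., A_{n+r}. *)
Fixpoint ext_cols (R : pzRingType) (n : nat) (A : 'M[R]_n)
    (p : nat -> nat -> R) (r : nat) : seq 'cV[R]_n :=
  if r is j.+1 then
    let s := ext_cols A p j in
    rcons s (\sum_(i < n + j) p i j *: s`_i)
  else [seq col i A | i <- enum 'I_n].

Definition ext_mx (R : pzRingType) (n : nat) (A : 'M[R]_n)
    (p : nat -> nat -> R) (r : nat) : 'M[R]_(n, n + r) :=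
  \matrix_(i, c) (ext_cols A p r)`_c i 0.

Definition coef_mx (R : pzRingType) (n : nat) (p : nat -> nat -> R) (r : nat) :
    'M[R]_((n + r).-1, r) :=
  \matrix_(i, j) if (i < n + j)%N then p i j
                 else if i == n + j :> nat then -1 else 0.

(* The columns of B whose index is not in J, in increasing order of index.  The
   default value of [nth] is irrelevant as soon as #|J| = r. *)
Definition del_cols (R : Type) (m n r : nat) (J : {set 'I_(n + r)})
    (B : 'M[R]_(m, n + r)) : 'M[R]_(m, n) :=
  colsub (fun k : 'I_n => nth (lshift r k) (enum (~: J)) k) B.

Section ExtMxSpec.
Variables (R : pzRingType) (n : nat) (A : 'M[R]_n) (p : nat -> nat -> R).

Lemma size_ext_cols r : size (ext_cols A p r) = (n + r)%N.
Proof.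
elim: r => [|r IHr] /=; first by rewrite size_map size_enum_ord addn0.
by rewrite size_rcons IHr addnS.
Qed.

Lemma nth_ext_cols_le r r' c : (r <= r')%N -> (c < n + r)%N ->
  (ext_cols A p r')`_c = (ext_cols A p r)`_c.
Proof.
move=> le_rr' lt_c; elim: r' le_rr' => [|r' IHr]; first by case: r lt_c.
rewrite leq_eqVlt => /predU1P[-> //|le_rr'] /=.
rewrite nth_rcons size_ext_cols (leq_trans lt_c) ?leq_add2l // IHr //.
Qed.

Lemma col_ext_mx r c : col c (ext_mx A p r) = (ext_cols A p r)`_c.
Proof. by apply/colP=> i; rewrite !mxE. Qed.

Lemma col_ext_mx_lshift r (j : 'I_n) : col (lshift r j) (ext_mx A p r) = col j A.
Proof.
rewrite col_ext_mx (@nth_ext_cols_le 0) ?addn0 //= (nth_map j) ?size_enum_ord //.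
by rewrite nth_ord_enum.
Qed.

Lemma col_ext_mx_rshift r (j : 'I_r) :
  col (rshift n j) (ext_mx A p r) =
  \sum_(i < n + r | (i < n + j)%N) p i j *: col i (ext_mx A p r).
Proof.
have lt_nj : (n + j <= n + r)%N by rewrite leq_add2l ltnW.
rewrite col_ext_mx (@nth_ext_cols_le j.+1) ?addnS //=.
rewrite nth_rcons size_ext_cols ltnn eqxx.
rewrite (big_ord_widen _ (fun i => p i j *: (ext_cols A p j)`_i) lt_nj).
apply: eq_bigr => i lt_i; rewrite col_ext_mx (@nth_ext_cols_le j r) //.
exact: ltnW.
Qed.

End ExtMxSpec.

Lemma del_cols_spec (n r : nat) (J : {set 'I_(n + r)}) : #|J| = r ->
  exists2 f : 'I_n -> 'I_(n + r),
    {homo f : k l / (k < l)%N} /\ (forall c, (c \in codom f) = (c \notin J))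
  & forall (R : Type) (m : nat) (B : 'M[R]_(m, n + r)),
      del_cols J B = colsub f B.
Proof.
move=> cardJ; pose f k := nth (lshift r k) (enum (~: J)) k.
have sz : size (enum (~: J)) = n.
  by rewrite -cardE cardsCs setCK card_ord cardJ addnK.
exists f => //; split=> [k l lt_kl|c].
  have srt : sorted (fun a b : 'I_(n + r) => (a < b)%N) (enum (~: J)).
    rewrite /enum_mem; apply: sorted_filter; first by move=> ? ? ?; apply: ltn_trans.
    have := iota_ltn_sorted 0 (n + r).
    by rewrite -val_enum_ord sorted_map -enumT.
  rewrite /f (set_nth_default (lshift r l)) ?sz //.
  apply: (sorted_ltn_nth _ (lshift r l) srt) => //; rewrite ?inE ?sz //.
  by move=> ? ? ?; apply: ltn_trans.
rewrite -in_setC -[RHS]mem_enum; apply/codomP/idP => [[k ->]|c_in].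
  by rewrite mem_nth ?sz.
have lt_c : (index c (enum (~: J)) < n)%N by move: c_in; rewrite -index_mem sz.
by exists (Ordinal lt_c); rewrite /f nth_index.
Qed.

(* Main.v *)
(* Let B be the extended matrix, K the set of remaining columns, E the matrix with
   columns e_k (k in K), and P' the matrix P completed by one more row, so that
   B P' = 0.  Multiplying [E | P'] on the left by [B ; 0 1] gives a block
   triangular matrix with diagonal blocks B E, of determinant M, and a triangular
   block with -1 on the diagonal; hence det A det [E | P'] = (-1)^r M.  Moving the
   rows of index in K to the top turns [E | P'] into a block triangular matrix with
   diagonal blocks 1 and Q, and the sign of that row permutation is found by
   counting its inversions. *)
Require Import Defs.
From mathcomp Require Import all_boot all_order all_algebra.
From mathcomp Require Import fingroup perm.
From mathcomp Require Import zify.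

Import GRing.Theory Num.Theory.
Local Open Scope ring_scope.

(* Compare the signs of the Vandermonde determinants at (0, ..., n-1) and at
   (s 0, ..., s (n-1)). *)
Lemma odd_perm_inversions n (s : 'S_n) :
  odd_perm s = odd (\sum_(i < n) \sum_(k < n | (i < k)%N) (s k < s i))%N.
Proof.
apply: (@signr_inj int); rewrite signr_odd.
pose a : 'rV[int]_n := \row_k (k : nat)%:R.
have := congr1 Num.sg (det_Vandermonde (\row_k a 0 (s k))).
have -> : Vandermonde n (\row_k a 0 (s k)) = col_perm s (Vandermonde n a).
  by apply/matrixP=> i k; rewrite !mxE.
have sgM := big_morph Num.sg (@sgrM int) (@sgr1 int).
rewrite col_permE det_mulmx det_perm sgrM det_Vandermonde.
rewrite odd_permV sgrX sgrN sgr1 !sgM.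
(* At (0, ..., n-1) all factors are positive, so only the sign of [s] remains on that side; at the
   permuted points a factor is negative exactly at an inversion. *)
rewrite big1 ?mul1r => [->|i _].
  rewrite -prodrXr; apply: eq_bigr => i _; rewrite sgM -prodrXr.
  apply: eq_bigr => k lt_ik; rewrite !mxE.
  have := lt_ik; have : s i != s k.
    by rewrite (inj_eq perm_inj) neq_ltn lt_ik.
  rewrite -val_eqE neq_ltn /=; case: ltngtP => // lt_s _ _.
    by rewrite gtr0_sg // subr_gt0 ltr_nat.
  by rewrite ltr0_sg // subr_lt0 ltr_nat.
rewrite sgM big1 // => k lt_ik; rewrite !mxE.
by rewrite gtr0_sg // subr_gt0 ltr_nat.
Qed.

Lemma sum_ltn_ord m (a : 'I_m) : (\sum_(c < m) (a < c) + a.+1 = m)%N.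
Proof.
rewrite -(big_mkord xpredT (fun c => nat_of_bool (a < c)%N)).
rewrite (big_cat_nat (n := a.+1)) //= big1_seq => [|c].
  rewrite (@eq_big_nat _ _ _ _ _ _ (fun=> 1%N)) => [|c /andP[-> _] //].
  by rewrite sum_nat_const_nat muln1 add0n subnK.
by rewrite mem_index_iota /=; lia.
Qed.

Section Shuffle.

Variables (n r : nat) (f : 'I_n -> 'I_(n + r)) (g : 'I_r -> 'I_(n + r)).
Hypotheses (f_homo : {homo f : k l / (k < l)%N})
           (g_homo : {homo g : k l / (k < l)%N})
           (f_neq_g : forall k l, f k != g l).

Lemma ltn_mono_homo m (h : 'I_m -> 'I_(n + r)) :
  {homo h : k l / (k < l)%N} -> {mono h : k l / (k < l)%N}.
Proof.
move=> h_homo k l; case: (ltngtP k l) => [/h_homo-> //|/h_homo|/val_inj->].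
  by move=> /ltnW; rewrite leqNgt => /negbTE.
by rewrite ltnn.
Qed.

(** Lists the values of [f] (kept indices) first, then those of [g] (deleted indices). *)
Definition shuffle (i : 'I_(n + r)) : 'I_(n + r) :=
  match split i with inl k => f k | inr l => g l end.

Lemma shuffle_lshift k : shuffle (lshift r k) = f k.
Proof. by rewrite /shuffle (unsplitK (inl k)). Qed.

Lemma shuffle_rshift l : shuffle (rshift n l) = g l.
Proof. by rewrite /shuffle (unsplitK (inr l)). Qed.

Lemma shuffle_inj : injective shuffle.
Proof.
have inj m (h : 'I_m -> 'I_(n + r)) :
    {homo h : k l / (k < l)%N} -> injective h.
  move=> h_homo k l eq_h.
  by case: (ltngtP k l) => [/h_homo|/h_homo|/val_inj //]; rewrite eq_h ltnn.
move=> a b; case: (split_ordP a) => k ->; case: (split_ordP b) => l ->;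
  rewrite ?shuffle_lshift ?shuffle_rshift.
- by move/(inj _ _ f_homo)->.
- by move/eqP; rewrite (negPf (f_neq_g _ _)).
- by move/eqP; rewrite eq_sym (negPf (f_neq_g _ _)).
- by move/(inj _ _ g_homo)->.
Qed.

(** As [f] and [g] increase, every inversion pairs a value of [f] with a smaller value of [g]. Above
    [g l] lie r - l - 1 values of [g], hence n + l - [g l] values of [f]; sum over l. The sum of the
    [g l] stays on the left to avoid truncated subtraction. *)
Lemma shuffle_inversions :
  (\sum_(i < n + r) \sum_(k < n + r | (i < k)%N) (shuffle k < shuffle i)
   + \sum_(l < r) g l = n * r + 'C(r, 2))%N.
Proof.
have f_mono := ltn_mono_homo _ _ f_homo.
have g_mono := ltn_mono_homo _ _ g_homo.
have E l : (\sum_(k < n) (g l < f k) + g l = n + l)%N.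
  have := sum_ltn_ord _ (g l); rewrite (reindex_inj shuffle_inj) big_split_ord /=.
  under eq_bigr do rewrite shuffle_lshift.
  under [X in (_ + X + _)%N]eq_bigr do rewrite shuffle_rshift g_mono.
  have := sum_ltn_ord _ l.
  by move: (\sum_(c < r) _)%N (\sum_(i < n) _)%N => a b; lia.
rewrite big_split_ord /= [X in (_ + X + _)%N]big1 ?addn0 => [|l _].
  rewrite (eq_bigr (fun k => \sum_(l < r) (g l < f k)))%N => [|k _].
    rewrite exchange_big -big_split /= (eq_bigr (fun l : 'I_r => n + l)%N) //.
    by rewrite big_split /= sum_nat_const card_ord mulnC -bin2_sum big_mkord.
  rewrite big_mkcond big_split_ord /= big1 ?add0n => [|i _].
    apply: eq_bigr => l _.
    by rewrite shuffle_rshift shuffle_lshift ltn_addr.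
  by case: ifP => // lt_ki; rewrite !shuffle_lshift f_mono ltnNge ltnW.
rewrite big_mkcond big_split_ord /= !big1 // => i _; case: ifP => //=; last first.
  by have := ltn_ord i; lia.
by rewrite ltn_add2l => lt_li; rewrite !shuffle_rshift g_mono ltnNge ltnW.
Qed.

Lemma det_row_mx_shuffle (R : comPzRingType) (W : 'M[R]_(n + r, r)) :
  \det (row_mx (colsub f 1%:M) W) =
  (-1) ^+ (n * r + \sum_(l < r) g l + 'C(r, 2)) * \det (rowsub g W).
Proof.
pose s := perm shuffle_inj.
have -> : (-1) ^+ (n * r + \sum_(l < r) g l + 'C(r, 2)) = (-1) ^+ odd_perm s :> R.
  rewrite -signr_odd odd_perm_inversions; congr (_ ^+ (nat_of_bool _)).
  under [in RHS]eq_bigr do under eq_bigr do rewrite !permE.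
  (* Only parity matters, so the sum of the [g l] may change sides without changing sign. *)
  have /(congr1 odd) := shuffle_inversions; rewrite !oddD.
  by do 4!case: (odd _).
apply: (canRL (signrMK _)); rewrite -det_perm -det_mulmx -row_permE.
have -> : row_perm s (row_mx (colsub f 1%:M) W) =
          block_mx 1%:M (rowsub f W) 0 (rowsub g W).
  apply/matrixP=> a b; rewrite mxE permE.
  case: (split_ordP a) => k ->; case: (split_ordP b) => l ->;
    rewrite ?shuffle_lshift ?shuffle_rshift ?row_mxEl ?row_mxEr.
  - rewrite block_mxEul !mxE; congr (_ *+ _).
    by rewrite -!shuffle_lshift (inj_eq shuffle_inj) (inj_eq (@lshift_inj _ _)).
  - by rewrite block_mxEur !mxE.
  - by rewrite block_mxEdl !mxE eq_sym (negPf (f_neq_g _ _)).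
  - by rewrite block_mxEdr !mxE.
by rewrite det_ublock det1 mul1r.
Qed.

End Shuffle.

(* [coef_mx] completed by the row of index n + r - 1, so that its columns are
   linear relations between the columns of [ext_mx]. *)
Definition rel_mx (R : pzRingType) (n : nat) (p : nat -> nat -> R) (r : nat) :
    'M[R]_(n + r, r) :=
  \matrix_(i, j) if (i < n + j)%N then p i j
                 else if i == n + j :> nat then -1 else 0.

(** In column j the entry -1 in row n + j cancels the combination that defines column n + j of
    [ext_mx]. *)
Lemma ext_mx_rel (R : comPzRingType) (n r : nat) (A : 'M[R]_n) p :
  ext_mx A p r *m rel_mx R n p r = 0.
Proof.
apply/matrixP=> i j; rewrite mxE [RHS]mxE.
have /(congr1 (fun u : 'cV_n => u i 0)) := col_ext_mx_rshift A p j.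
rewrite mxE summxE => E.
rewrite (bigID (fun k : 'I_(n + r) => (k < n + j)%N)) /=.
rewrite [X in _ + X](bigD1 (rshift n j)) /= ?ltnn //.
rewrite [X in _ + (_ + X)]big1 ?addr0 => [|k /andP[/negPf le_jk ne_kj]].
  rewrite E mxE ltnn eqxx mulrN1; apply/eqP; rewrite subr_eq0; apply/eqP.
  by apply: eq_bigr => k lt_kj; rewrite [X in _ * X]mxE lt_kj mulrC [RHS]mxE [in RHS]mxE.
rewrite [X in _ * X]mxE le_jk.
by move: ne_kj; rewrite -val_eqE /= => /negPf->; rewrite mulr0.
Qed.

Lemma det_dsubmx_rel (R : comPzRingType) (n r : nat) p :
  \det (dsubmx (rel_mx R n p r) : 'M[R]_r) = (-1) ^+ r.
Proof.
(* The block is upper triangular, whereas [det_trig] expects a lower triangular matrix. *)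
rewrite -det_tr det_trig; last first.
  apply/is_trig_mxP=> i k lt_ik; rewrite !mxE /= ltn_add2l eqn_add2l.
  by rewrite ltnNge ltnW // gtn_eqF.
under eq_bigr do rewrite !mxE /= ltnn eqxx.
by rewrite prodr_const card_ord.
Qed.

Lemma lsubmx_ext (R : pzRingType) (n r : nat) (A : 'M[R]_n) p :
  lsubmx (ext_mx A p r) = A.
Proof.
apply/matrixP=> i k.
have := congr1 (fun u : 'cV_n => u i 0) (col_ext_mx_lshift A p r k).
by rewrite !mxE.
Qed.

Lemma det_colsub_ext (R : comPzRingType) (n r : nat) (A : 'M[R]_n) p
    (f : 'I_n -> 'I_(n + r)) :
  \det A * \det (row_mx (colsub f 1%:M) (rel_mx R n p r)) =
  (-1) ^+ r * \det (colsub f (ext_mx A p r)).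
Proof.
set B := ext_mx A p r; set C := row_mx _ _.
pose T := col_mx B (row_mx 0 1%:M : 'M[R]_(r, n + r)).
have detT : \det T = \det A.
  by rewrite /T -[B]hsubmxK -/(block_mx _ _ _ _) det_ublock det1 mulr1 lsubmx_ext.
have TC : T *m C = block_mx (colsub f B) 0
    (row_mx 0 1%:M *m colsub f 1%:M) (dsubmx (rel_mx R n p r)).
  (* The upper right block vanishes by [ext_mx_rel]; the lower left one does not affect the
     determinant. *)
  rewrite /T /C mul_col_row mulmx_colsub mulmx1 ext_mx_rel; congr block_mx.
  by rewrite -[rel_mx R n p r in LHS]vsubmxK mul_row_col mul0mx mul1mx add0r.
by rewrite -detT -det_mulmx TC det_lblock det_dsubmx_rel mulrC.
Qed.

Theorem theorem1 (R : comPzRingType) (n r : nat) (hn : (0 < n)%N) (hr : (0 < r)%N)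
    (A : 'M[R]_n) (p : nat -> nat -> R)
    (j : 'I_r -> 'I_((n + r).-1))
    (hj : forall k l : 'I_r, (k < l)%N -> (j k < j l)%N) :
  let P := coef_mx n p r in
  let J := [set widen_ord (leq_pred (n + r)) (j k) | k : 'I_r] in
  let M := \det (del_cols J (ext_mx A p r)) in
  let Q := rowsub j P in
  M = (-1) ^+ (n * r + \sum_(k < r) (j k).+1 + ((r - 1) * r) %/ 2)
      * \det Q * \det A.
Proof.
move=> P J M Q; pose g k := widen_ord (leq_pred (n + r)) (j k).
have g_homo : {homo g : k l / (k < l)%N} by exact: hj.
have cardJ : #|J| = r.
  rewrite card_imset ?card_ord // => k l /(congr1 val) /= eq_j.
  by case: (ltngtP k l) => [/hj|/hj|/val_inj //]; rewrite eq_j ltnn.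
have [f [f_homo f_codom] delE] := del_cols_spec cardJ.
have f_neq_g k l : f k != g l.
  apply: contraTneq (codom_f f k) => ->.
  by rewrite f_codom negbK; apply/imsetP; exists l.
(* The row added in [rel_mx] is never selected, since [j] takes values below n + r - 1. *)
have -> : Q = rowsub g (rel_mx R n p r) by apply/matrixP=> k l; rewrite !mxE.
have := det_colsub_ext _ _ _ A p f.
rewrite (det_row_mx_shuffle _ _ _ _ f_homo g_homo f_neq_g) -delE -/M.
move/(canLR (signrMK _))<-.
rewrite [\det A * _]mulrC !mulrA -exprD; congr (_ ^+ _ * _ * _).
(* Passing from 0-based to 1-based indices adds r to the exponent, which accounts for the factor
   (-1)^r of [det_colsub_ext]. *)
under [in RHS]eq_bigr do rewrite -addn1.
rewrite big_split /= sum_nat_const card_ord muln1 bin2 subn1 divn2 (mulnC r.-1).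
by rewrite addnC -!addnA [(_./2 + r)%N]addnC.
Qed.
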